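(* There exists a constant $\varepsilon>0$ such that every non-adaptive $\varepsilon$-tester for bipartiteness of graphs on vertex set $[n]$ in the rejection sampling model has cost $\widetilde{\Omega}(n^2)$.
   Context: Rejection sampling model: the input is an unknown graph $G=([n],E)$. A query is a set $L\subseteq[n]$; the oracle samples an edge $(\boldsymbol i,\boldsymbol j)$ uniformly at random from $E$ and returns $\{\boldsymbol i,\boldsymbol j\}\cap L$ (which is either $\emptyset$, a single vertex, or the whole edge). The cost of an algorithm making queries $L_1,\dots,L_t$ is $\sum_{i=1}^t|L_i|$. An algorithm is non-adaptive if its query sets are fixed in advance, independently of answers to previous queries. A graph $G$ on $[n]$ is $\varepsilon$-far from bipartite if every bipartite graph $H$ on $[n]$ differs from $G$ on at least $\varepsilon n^2$ edges. An $\varepsilon$-tester for bipartiteness outputs ''accept'' with probability at least $2/3$ if $G$ is bipartite and ''reject'' with probability at least $2/3$ if $G$ is $\varepsilon$-far from bipartite. The notation $\widetilde{\Omega}(f)$ means $\Omega(f/\log^c f)$ for some absolute constant $c$. *)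

(* Defs.v *)
From HB Require Import structures.
From mathcomp Require Import all_boot all_order all_algebra.
From mathcomp Require Import all_classical all_reals all_analysis.

Set Implicit Arguments.
Unset Strict Implicit.
Unset Printing Implicit Defensive.

Import Order.TTheory GRing.Theory Num.Theory.

Local Open Scope classical_set_scope.
Local Open Scope ring_scope.

Record graph (n : nat) := Graph {
  edges : {set {set 'I_n}};
  edges_card2 : forall e, e \in edges -> #|e| = 2%N
}.

Definition bipartite (n : nat) (G : graph n) : Prop :=
  exists side : 'I_n -> bool,
    forall i j : 'I_n, [set i; j]%SET \in edges G -> side i != side j.

Definition edge_diff (n : nat) (G H : graph n) : nat :=
  #|(edges G :\: edges H) :|: (edges H :\: edges G)|.

Definition far_from_bipartite (R : realType) (n : nat) (eps : R) (G : graph n)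
    : Prop :=
  forall H : graph n, bipartite H ->
    eps * n%:R ^+ 2 <= (edge_diff G H)%:R.

(* A randomized non-adaptive algorithm: a seed is drawn from an arbitrary
   probability space, independently of the oracle, and determines both the
   query sets and the decision rule mapping the list of answers to
   accept (true) or reject (false).  Only [decide] sees the answers. *)
Record nonadaptive_alg (R : realType) (n : nat) := NonadaptiveAlg {
  seed_display : measure_display;
  seed : measurableType seed_display;
  seed_law : probability seed R;
  queries : seed -> seq {set 'I_n};
  decide : seed -> seq {set 'I_n} -> bool;
  measurable_queries : forall Ls, measurable [set w | queries w = Ls];
  measurable_decide : forall ans, measurable [set w | decide w ans]
}.

Definition oracle_answers (n : nat) (es Ls : seq {set 'I_n})
    : seq {set 'I_n} :=
  [seq p.1 :&: p.2 | p <- zip es Ls].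

(* Probability that the answers to the queries Ls satisfy D when one edge of G
   is drawn uniformly and independently for each query.  Meaningful only when G
   has an edge. *)
Definition answers_prob (R : realType) (n : nat) (G : graph n)
    (Ls : seq {set 'I_n}) (D : seq {set 'I_n} -> bool) : R :=
  #|[set es : (size Ls).-tuple {set 'I_n} |
      all (fun e => e \in edges G) es && D (oracle_answers es Ls)]%SET|%:R
  / (#|edges G| ^ size Ls)%:R.

Definition output_prob (R : realType) (n : nat) (A : nonadaptive_alg R n)
    (G : graph n) (b : bool) : \bar R :=
  (\int[seed_law A]_w
     (answers_prob R G (queries w) (fun ans => decide w ans == b))%:E)%E.

(* The oracle samples an edge, so it is undefined on edgeless graphs; nothing
   is required of the algorithm on those. *)
Definition bipartiteness_tester (R : realType) (n : nat) (eps : R)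
    (A : nonadaptive_alg R n) : Prop :=
  forall G : graph n, edges G != finset.set0 ->
    (bipartite G -> ((2 / 3 : R)%:E <= output_prob A G true)%E) /\
    (far_from_bipartite eps G ->
       ((2 / 3 : R)%:E <= output_prob A G false)%E).

(* Worst case over the seed. *)
Definition cost (R : realType) (n : nat) (A : nonadaptive_alg R n) : \bar R :=
  ereal_sup (range (fun w : seed A => (\sum_(L <- queries w) #|L|)%N%:R%:E)).

(* Main.v *)
Require Import Defs.
From HB Require Import structures.
From mathcomp Require Import all_boot all_order all_algebra.
From mathcomp Require Import all_classical all_reals all_analysis.
From mathcomp Require Import measurable_realfun zify ring lra.

(** Pair the vertices up ([mate]) and colour each pair by a random sign [s],
    one end of the pair getting the sign and the other its opposite.  Among the
    edges that do not join mates, the bichromatic ones form a bipartite graph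
    and the monochromatic ones are far from bipartite; both sets contain half
    of all such edges.  Enlarging every query to a union of pairs, an answer
    that is not a whole edge has the same law under both graphs and under the
    uniform distribution on all non-mate edges, because replacing the unseen
    endpoint by its mate reverses the sign of the edge.  Relative to that
    uniform distribution, the chi-square divergence of the answers, mixed over
    [s], is at most
    [E exp (\sum_L T_L ^ 2 / (2 N)) - 1], where [N] is the number of edges and
    [T_L] is a sum of at most [|L|] independent signs with coefficients at most
    2.  Jensen's inequality with weights proportional to [|L|] bounds this by
    [exp (4 \sum_L |L| / N) - 1], which is small unless the cost is of order
    [n ^ 2].  In particular the logarithmic factor is not needed: [c = 0]. *)

Set Implicit Arguments.
Unset Strict Implicit.
Unset Printing Implicit Defensive.

Import Order.TTheory GRing.Theory Num.Theory.

Local Open Scope ring_scope.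

(** * Exponential moments of squared signed sums *)

(** Squaring [expR (y / 2) * (1 - y / 2) <= 1] gives [expR y <= 1 / (1 - y / 2) ^+ 2]. The threshold
    1/3 keeps the term [1 - 3 * y] nonnegative when this is compared with the quadratic. *)
Lemma expR_le_quadratic (R : realType) (y : R) :
  `|y| <= 1 / 3 -> expR y <= 1 + y + y ^+ 2.
Proof.
rewrite ler_norml => /andP[y_ge y_le].
set z := 1 - y / 2; have z_gt0 : 0 < z by rewrite /z; lra.
have pz_le1 : expR (y / 2) * z <= 1.
  rewrite -[leRHS](expRxMexpNx_1 (y / 2)) ler_wpM2l ?expR_ge0 //.
  exact: expR_ge1Dx.
have p2z2_le1 : (expR (y / 2) * z) ^+ 2 <= 1.
  by rewrite expr_le1 // mulr_ge0 ?expR_ge0 // ltW.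
have -> : expR y = expR (y / 2) ^+ 2 by rewrite -expRM_natl; congr expR; lra.
rewrite -(ler_pM2r (exprn_gt0 2 z_gt0)) -exprMn (le_trans p2z2_le1) //.
have -> : (1 + y + y ^+ 2) * z ^+ 2 = 1 + y ^+ 2 * ((1 - 3 * y) / 4 + y ^+ 2 / 4).
  by rewrite /z; field.
by rewrite lerDl mulr_ge0 ?sqr_ge0 // addr_ge0 ?divr_ge0 ?sqr_ge0 //; lra.
Qed.

Lemma expR_sym_le (R : realType) (y : R) :
  `|y| <= 1 / 3 -> expR y + expR (- y) <= 2 * expR (y ^+ 2).
Proof.
move=> y_le; have yN_le : `|- y| <= 1 / 3 by rewrite normrN.
have := expR_le_quadratic y_le; have := expR_le_quadratic yN_le.
have := expR_ge1Dx (y ^+ 2); rewrite sqrrN; lra.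
Qed.

(** Each exponential lies above the tangent at the mean [mu], and the deviations from [mu] average
    to zero. *)
Lemma expR_jensen (R : realType) (I : Type) (s : seq I) (w z : I -> R) :
  (forall i, 0 <= w i) -> \sum_(i <- s) w i = 1 ->
  expR (\sum_(i <- s) w i * z i) <= \sum_(i <- s) w i * expR (z i).
Proof.
move=> w_ge0 w_sum1; set mu := \sum_(i <- s) w i * z i.
have tangent i : expR mu * (1 + (z i - mu)) <= expR (z i).
  by rewrite -[in leRHS](subrKC mu (z i)) expRD ler_wpM2l ?expR_ge0 ?expR_ge1Dx.
have wtangent i : w i * (expR mu * (1 + (z i - mu))) <= w i * expR (z i).
  by rewrite ler_wpM2l.
apply: (le_trans _ (ler_sum s (fun i _ => wtangent i))).
rewrite (eq_bigr (fun i => expR mu * (1 - mu) * w i + expR mu * (w i * z i))).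
  2: by move=> i _; ring.
rewrite big_split /= -!mulr_sumr w_sum1 -/mu.
by rewrite (_ : _ + _ = expR mu) //; ring.
Qed.

Lemma norm_signed_sum_le (R : realType) (T : finType) (s : seq T) (c : T -> R)
    (f : T -> bool) :
  (forall v, `|c v| <= 2) ->
  `|\sum_(v <- s) c v * (-1) ^+ f v| <= 2 * (size s)%:R.
Proof.
move=> c_le; apply: le_trans (ler_norm_sum _ _ _) _.
elim: s => [|v s IH]; first by rewrite big_nil mulr0.
rewrite big_cons /= -[(size s).+1%:R]natr1 mulrDr mulr1 addrC lerD //.
by rewrite normrM normrX normrN1 expr1n mulr1.
Qed.

(* Averaging over one sign replaces the exponent [a] by [a + 16 a^2] at the
   price of a factor [expR (4 a)]; over all signs the exponent at most doubles. *)
Lemma rademacher_sqr_expR_moment (R : realType) (T : finType) (s : seq T)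
    (c : T -> R) (a : R) :
  uniq s -> (forall v, `|c v| <= 2) -> 0 <= a -> 32 * a * (size s)%:R <= 1 ->
  \sum_(f : {ffun T -> bool}) expR (a * (\sum_(v <- s) c v * (-1) ^+ f v) ^+ 2)
    <= #|{ffun T -> bool}|%:R * expR (8 * a * (size s)%:R).
Proof.
move=> + c_le; elim: s a => [|v s IH] a /=.
  move=> _ _ _; under eq_bigr do rewrite big_nil expr0n mulr0 expR0.
  by rewrite mulr0 expR0 mulr1 sumr_const.
move=> /andP[vNs uniq_s] a_ge0.
set k := (size s)%:R : R; have k_ge0 : 0 <= k by rewrite ler0n.
rewrite -[(size s).+1%:R]natr1 -/k => a_le.
have ak_le : 32 * a * k <= 1 by nra.
have a_le1 : 32 * a <= 1 by nra.
pose a' := a + 16 * a ^+ 2.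
have a'_ge0 : 0 <= a' by rewrite /a'; nra.
have a'k_le : 32 * a' * k <= 1.
  (* Removing one term frees [32 a] in the hypothesis; the increase [512 a^2 k] caused by [a'] uses
     at most [16 a] of it. *)
  have : a * (32 * a * k) <= a by rewrite ler_piMr.
  by rewrite /a'; lra.
have {}IH := IH a' uniq_s a'_ge0 a'k_le.
pose X f := \sum_(v <- s) c v * (-1) ^+ (f : {ffun T -> bool}) v.
(* Pairing [f] with its flip at [v] averages over the sign of [v] alone, since [X] does not involve
   [v]. *)
pose flip (f : {ffun T -> bool}) := [ffun u => f u (+) (u == v)].
have flipK : involutive flip.
  by move=> f; apply/ffunP=> u; rewrite !ffunE -addbA addbb addbF.
have Xflip f : X (flip f) = X f.
  rewrite /X; apply: eq_big_seq => u us; rewrite ffunE.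
  by case: eqP us vNs => [-> ->|]; rewrite ?addbF.
pose F f := expR (a * (\sum_(u <- v :: s) c u * (-1) ^+ (f : {ffun T -> bool}) u) ^+ 2).
rewrite -/(F _).
have F2 f : F f + F (flip f) <= 2 * (expR (4 * a) * expR (a' * X f ^+ 2)).
  rewrite /F !big_cons -/(X _) -/(X _) Xflip ffunE eqxx addbT signrN mulrN.
  set d := c v * _; have d_le : `|d| <= 2 by rewrite normrM normrX normrN1 expr1n mulr1.
  move: d d_le => d d_le.
  have d2_le : d ^+ 2 <= 4.
    by move: d_le; rewrite ler_norml => /andP[]; nra.
  have X_le : `|X f| <= 2 * k by exact: norm_signed_sum_le.
  set x := X f in X_le *.
  have -> : a * (d + x) ^+ 2 = (a * d ^+ 2 + a * x ^+ 2) + 2 * a * d * x by ring.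
  have -> : a * (- d + x) ^+ 2 = (a * d ^+ 2 + a * x ^+ 2) - 2 * a * d * x by ring.
  rewrite [expR (_ + 2 * _ * _ * _)]expRD [expR (_ - _)]expRD -mulrDr.
  have y_le : `|2 * a * d * x| <= 1 / 3.
    rewrite !normrM ger0_norm // (ger0_norm a_ge0) -mulrA.
    have : `|d| * `|x| <= 2 * (2 * k) by rewrite ler_pM.
    have dx_ge0 : 0 <= `|d| * `|x| by rewrite mulr_ge0.
    move=> dx_le; have : a * (`|d| * `|x|) <= a * (2 * (2 * k)) by rewrite ler_wpM2l.
    lra.
  apply: le_trans (ler_wpM2l (expR_ge0 _) (expR_sym_le y_le)) _.
  rewrite mulrCA ler_wpM2l // -!expRD ler_expR.
  have x2_ge0 := sqr_ge0 x.
  have ad2 : a * d ^+ 2 <= a * 4 by rewrite ler_wpM2l.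
  (* The squared cross term, with [d ^+ 2 <= 4], is the source of [16 a^2] in [a']. *)
  have : (2 * a * d * x) ^+ 2 <= 16 * a ^+ 2 * x ^+ 2.
    have -> : (2 * a * d * x) ^+ 2 = 4 * a ^+ 2 * x ^+ 2 * d ^+ 2 by ring.
    have -> : 16 * a ^+ 2 * x ^+ 2 = 4 * a ^+ 2 * x ^+ 2 * 4 by ring.
    by rewrite ler_wpM2l // mulr_ge0 ?sqr_ge0 // mulr_ge0 ?sqr_ge0.
  by rewrite /a'; lra.
have -> : \sum_f F f = (\sum_f (F f + F (flip f))) / 2.
  rewrite big_split /= -(reindex_inj (inv_inj flipK) (P := predT)) /=; lra.
rewrite ler_pdivrMr //; apply: le_trans (ler_sum _ (fun f _ => F2 f)) _.
rewrite -!mulr_sumr mulrC ler_pM2r //.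
apply: le_trans (ler_wpM2l (expR_ge0 _) IH) _.
rewrite mulrCA ler_wpM2l // -expRD ler_expR.
(* The new exponent is [4 a + 8 a k + 128 a^2 k], and its last term is at most [4 a]. *)
have : a * (32 * a * k) <= a by rewrite ler_piMr.
by rewrite /a'; lra.
Qed.

(** * The pairing of the vertices *)

(** The index of the pair [{2v, 2v+1}] is again typed as a vertex, so that one sign per pair can be
    read off a function on ['I_n]. *)
Definition base (n : nat) (u : 'I_n) : 'I_n := insubd u u./2.

(* For odd [n] the last vertex has no partner and is its own mate. *)
Definition mate (n : nat) (u : 'I_n) : 'I_n :=
  insubd u (if odd u then u.-1 else u.+1).

Definition paired (n : nat) (u : 'I_n) : bool := mate u != u.

Section Mate.
Variable n : nat.
Implicit Types u w : 'I_n.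

Lemma val_base u : base u = u./2 :> nat.
Proof. by rewrite val_insubd; have := ltn_ord u; case: ifP => //; lia. Qed.

Lemma val_mate u :
  mate u = (if odd u then u.-1 else if (u.+1 < n)%N then u.+1 else u) :> nat.
Proof.
rewrite val_insubd; have := ltn_ord u.
by case: (odd u); case: ifP => //; lia.
Qed.

Lemma mateK : involutive (@mate n).
Proof.
move=> u; apply/val_inj => /=; rewrite !val_mate; have := ltn_ord u.
by case: (boolP (odd u)) => u_odd; repeat case: ifP; lia.
Qed.

Lemma base_mate u : base (mate u) = base u.
Proof.
apply/val_inj => /=; rewrite !val_base val_mate.
by case: (boolP (odd u)) => u_odd; repeat case: ifP; lia.
Qed.

Lemma base_eq u w : base u = base w -> w = u \/ w = mate u.
Proof.
move=> /(congr1 val) /=; rewrite !val_base => e.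
have := ltn_ord u; have := ltn_ord w.
have : val w = val u \/ val w = val (mate u).
  rewrite /= val_mate; have := ltn_ord w.
  by case: (boolP (odd u)) => u_odd; repeat case: ifP; lia.
by case=> /val_inj ->; [left | right].
Qed.

Lemma odd_mate u : paired u -> odd (mate u) = ~~ odd u.
Proof.
rewrite /paired -val_eqE /= val_mate.
by case: (boolP (odd u)) => u_odd; repeat case: ifP; lia.
Qed.

Lemma paired_mate u : paired (mate u) = paired u.
Proof. by rewrite /paired mateK eq_sym. Qed.

Lemma card_paired : (n.-1 <= #|[set u : 'I_n | paired u]|)%N.
Proof.
have := cardsC [set u : 'I_n | paired u]; rewrite card_ord.
have : (#|~: [set u : 'I_n | paired u]| <= 1)%N.
  apply/card_le1P => u; rewrite !inE negbK => /eqP/(congr1 val)/= mu w.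
  rewrite !inE negbK; apply/eqP/eqP => [/(congr1 val)/= mw|->]; last first.
    exact/val_inj.
  apply/val_inj => /=; move: mu mw; rewrite !val_mate.
  have := ltn_ord u; have := ltn_ord w.
  by case: (boolP (odd u)) => ?; case: (boolP (odd w)) => ?; repeat case: ifP; lia.
lia.
Qed.

End Mate.

(** * Sums over the edges that do not join mates *)

(** Every two-element set arises from exactly two ordered pairs. *)
Lemma sum_set2_pairs (R : comNzRingType) (T : finType) (A : {set {set T}})
    (F : {set T} -> R) : (forall e, e \in A -> #|e| = 2%N) ->
  2 * \sum_(e in A) F e =
  \sum_u \sum_(w | [set u; w] \in A) F [set u; w].
Proof.
move=> A2; rewrite pair_big_dep /=.
rewrite (partition_big (fun p : T * T => [set p.1; p.2]) [in A]) //=.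
rewrite mulr_sumr; apply: eq_bigr => e eA.
rewrite (eq_bigr (fun=> F e)); last by move=> p /andP[_ /eqP->].
rewrite sumr_const mulr_natl; apply: (congr1 (GRing.natmul (F e))).
have /eqP/cards2P[x [y [xy e_xy]]] := A2 _ eA.
apply/esym; rewrite (eq_card (B := mem [set (x, y); (y, x)])) ?cards2 ?xpair_eqE ?(negbTE xy) //.
move=> [u w]; rewrite !inE /= !xpair_eqE; apply/andP/orP => [[_ /eqP E]|E].
  have ue : u \in [set x; y] by rewrite -e_xy -E set21.
  have we : w \in [set x; y] by rewrite -e_xy -E set22.
  have xe : x \in [set u; w] by rewrite E e_xy set21.
  have ye : y \in [set u; w] by rewrite E e_xy set22.
  move: ue we xe ye; rewrite !inE => /orP[]/eqP-> /orP[]/eqP->;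
    by rewrite !eqxx ?(eq_sym y x) ?(negbTE xy) /=; auto.
have E' : [set u; w] = e by case: E => /andP[/eqP-> /eqP->]; rewrite // e_xy finset.setUC.
by rewrite E' eA.
Qed.

(** The complete graph on the paired vertices minus the perfect matching of mates; a vertex that is
    its own mate lies in no such edge. *)
Definition base_edges (n : nat) : {set {set 'I_n}} :=
  [set e : {set 'I_n} | (#|e| == 2%N) && [forall u in e, mate u \notin e]].

Lemma base_edges_card2 n e : e \in base_edges n -> #|e| = 2%N.
Proof. by rewrite inE => /andP[/eqP]. Qed.

Lemma pair_base_edges n (u w : 'I_n) :
  ([set u; w] \in base_edges n) =
  [&& paired u, paired w, w != u & w != mate u].
Proof.
rewrite inE cards2 (eq_sym u w); case: (eqVneq w u) => [->|wu] /=.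
  by rewrite !andbF.
rewrite /paired; apply/forall_inP/and3P => [H|[pu pw wmu] z].
  have := H u; have := H w; rewrite !inE !eqxx orbT => /(_ isT) /norP[wu' ww].
  by move=> /(_ isT)/norP[-> uw]; split=> //; rewrite eq_sym.
rewrite !inE negb_or => /orP[]/eqP->; rewrite ?pu ?pw ?andbT //=.
  by rewrite eq_sym.
by rewrite -(inj_eq (inv_inj (@mateK n))) mateK.
Qed.

Lemma prod_set2 (R : comNzRingType) (T : finType) (g : T -> R) (u w : T) :
  w != u -> \prod_(v in [set u; w]) g v = g u * g w.
Proof.
by move=> wu; rewrite big_setU1 ?inE 1?eq_sym //= big_set1.
Qed.

(** The square expands over all ordered pairs of paired vertices; the subtracted terms are the pairs
    [(u, u)] and [(u, mate u)]. *)
Lemma sum_base_edges_prod (R : comNzRingType) n (g : 'I_n -> R) :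
  2 * \sum_(e in base_edges n) \prod_(u in e) g u =
  (\sum_(u | paired u) g u) ^+ 2
  - \sum_(u | paired u) (g u ^+ 2 + g u * g (mate u)).
Proof.
rewrite (sum_set2_pairs _ (@base_edges_card2 n)).
rewrite expr2 mulr_suml -sumrB [RHS]big_mkcond /=; apply: eq_bigr => u _.
case: ifP => pu; last first.
  by rewrite big_pred0 // => w; rewrite pair_base_edges pu.
rewrite mulr_sumr [in RHS](bigD1 u) //= [in RHS](bigD1 (mate u)) ?paired_mate ?pu //=.
rewrite -expr2 addrA addrC addrK; apply: eq_big => w.
  by rewrite pair_base_edges pu /= andbA.
by rewrite pair_base_edges => /and4P[_ _ wu _]; rewrite prod_set2.
Qed.

(** * Colourings and the cancellation of edge signs *)

Definition color (n : nat) (s : {ffun 'I_n -> bool}) (u : 'I_n) : bool :=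
  s (base u) (+) odd u.

(** On a two-element set this is [true] exactly when the edge is bichromatic, that is, when
    [edge_sign] is -1. Big operators over [e] avoid ordering its endpoints. *)
Definition edge_parity (n : nat) (s : {ffun 'I_n -> bool}) (e : {set 'I_n}) :=
  \big[addb/false]_(u in e) color s u.

Definition edge_sign (R : realType) (n : nat) (s : {ffun 'I_n -> bool})
  (e : {set 'I_n}) : R := \prod_(u in e) (-1) ^+ color s u.

(* [b = true] gives [K_{m,m}] minus a perfect matching, [b = false] two
   disjoint copies of [K_m], both with colour classes given by [color s]. *)
Definition colored_edges (n : nat) (s : {ffun 'I_n -> bool}) (b : bool) :=
  [set e in base_edges n | edge_parity s e == b].

Lemma colored_edges_card2 (n : nat) (s : {ffun 'I_n -> bool}) (b : bool) e :
  e \in colored_edges s b -> #|e| = 2%N.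
Proof. by rewrite inE => /andP[/base_edges_card2]. Qed.

Definition colored_graph (n : nat) (s : {ffun 'I_n -> bool}) (b : bool) :=
  Graph (@colored_edges_card2 n s b).

Definition mate_closed (n : nat) (L : {set 'I_n}) :=
  forall u, (mate u \in L) = (u \in L).

Section EdgeSign.
Variables (R : realType) (n : nat).
Implicit Types (s : {ffun 'I_n -> bool}) (e L : {set 'I_n}) (u w : 'I_n).

Local Notation K := (base_edges n).
Local Notation N := (#|base_edges n|%:R : R).

Lemma color_mate s u : paired u -> color s (mate u) = ~~ color s u.
Proof. by move=> pu; rewrite /color base_mate odd_mate // addbN. Qed.

Lemma edge_signE s e : edge_sign R s e = (-1) ^+ edge_parity s e.
Proof.
rewrite /edge_sign /edge_parity.
by elim/big_rec2: _ => [|u x b _ ->]; rewrite ?expr0 // signr_addb.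
Qed.

(** Membership is affine in the edge sign, so counting edges reduces to summing signs. *)
Lemma colored_edgesE s b e : e \in K ->
  (e \in colored_edges s b)%:R = (1 + (-1) ^+ b * edge_sign R s e) / 2 :> R.
Proof.
move=> eK; rewrite inE eK edge_signE /=.
by case: (edge_parity s e); case: b => /=; rewrite ?expr0 ?expr1 /=; lra.
Qed.

(** This makes a partial answer uninformative about the colouring: [phi] stands for any later use of
    the answer. *)
Lemma sum_base_edges_sign_off s L (phi : {set 'I_n} -> R) : mate_closed L ->
  \sum_(e in K | ~~ (e \subset L)) edge_sign R s e * phi (e :&: L) = 0.
Proof.
move=> closedL; pose A := [set e in K | ~~ (e \subset L)].
rewrite (eq_bigl [in A]); last by move=> e; rewrite !inE.
suff: 2 * \sum_(e in A) edge_sign R s e * phi (e :&: L) = 0 by lra.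
rewrite sum_set2_pairs; last by move=> e; rewrite inE => /andP[/base_edges_card2].
rewrite pair_big_dep /=; set S := \sum_(p | _) _.
(* The endpoint outside [L] is replaced by its mate: the answer is unchanged
   and the sign is reversed. *)
pose swap (p : 'I_n * 'I_n) :=
  if p.2 \in L then (mate p.1, p.2) else (p.1, mate p.2).
have swapK : involutive swap.
  by move=> [u w]; rewrite /swap /=; case wL: (w \in L); rewrite /= ?closedL wL mateK.
suff: S = - S by lra.
rewrite {1}/S (reindex_inj (inv_inj swapK)) /= /S -sumrN.
have inA u w : ([set u; w] \in A) =
    [&& paired u, paired w, w != u, w != mate u & ~~ ((u \in L) && (w \in L))].
  by rewrite inE pair_base_edges finset.subUset !finset.sub1set -!andbA.
have signA u w : w != u -> edge_sign R s [set u; w] = (-1) ^+ color s u * (-1) ^+ color s w.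
  exact: prod_set2.
have mate_inj := inv_inj (@mateK n).
have mate_eq u w : (mate u == w) = (u == mate w) by rewrite -(inj_eq mate_inj) mateK.
apply: eq_big => [[u w]|[u w]]; rewrite /swap /=; case wL: (w \in L) => /=.
- by rewrite !inA paired_mate closedL mateK wL;
    case: (paired u); case: (paired w); case: (w == u); case: (w == mate u).
- by rewrite !inA paired_mate closedL wL mate_eq (inj_eq mate_inj);
    case: (paired u); case: (paired w); case: (w == mate u); case: (w == u).
- rewrite inA mateK => /and5P[pmu pw wmu wu].
  rewrite closedL wL andbT => uNL; rewrite !signA // color_mate -?(paired_mate u) //.
  rewrite signrN !mulNr; congr (- (_ * phi _)); apply/setP => v; rewrite !inE.
  case vL: (v \in L); last by rewrite !andbF.
  have -> : (v == u) = false by apply: contraTF vL => /eqP->; exact: uNL.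
  have -> // : (v == mate u) = false.
  by apply: contraTF vL => /eqP->; rewrite closedL; exact: uNL.
- rewrite inA => /and5P[pu pmw mwu mwmu _].
  rewrite (inj_eq mate_inj) in mwmu.
  rewrite !signA // color_mate -?(paired_mate w) //.
  rewrite signrN mulrN !mulNr; congr (- (_ * phi _)); apply/setP => v; rewrite !inE.
  case vL: (v \in L); last by rewrite !andbF.
  have -> : (v == w) = false by apply: contraTF vL => /eqP->; exact: (negbT wL).
  have -> // : (v == mate w) = false.
  by apply: contraTF vL => /eqP->; rewrite closedL; exact: (negbT wL).
Qed.

End EdgeSign.

(** * Sizes of the coloured graphs and distance from bipartiteness *)

Lemma card_sum_indicator (R : nzSemiRingType) (T : finType) (A B : {set T}) :
  A \subset B -> #|A|%:R = \sum_(e in B) (e \in A)%:R :> R.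
Proof.
move=> /fintype.subsetP sAB.
rewrite -sum1_card natr_sum big_mkcond [RHS]big_mkcond; apply: eq_bigr => e _.
by case eA: (e \in A); [rewrite (sAB e eA) | case: ifP].
Qed.

Section ColoredGraph.
Variables (R : realType) (n : nat).
Implicit Types (s : {ffun 'I_n -> bool}) (e L : {set 'I_n}) (u w : 'I_n).

Local Notation K := (base_edges n).
Local Notation N := (#|base_edges n|%:R : R).

Lemma sum_base_edges_sign s : \sum_(e in K) edge_sign R s e = 0.
Proof.
have closed0 : mate_closed (finset.set0 : {set 'I_n}) by move=> u; rewrite !inE.
rewrite -[RHS](sum_base_edges_sign_off s (fun=> 1) closed0) big_mkcondr /=.
apply: eq_bigr => e eK; rewrite mulr1 finset.subset0 -cards_eq0.
by rewrite (base_edges_card2 eK).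
Qed.

Lemma sum_base_edges_sign_on s L : mate_closed L ->
  \sum_(e in K | e \subset L) edge_sign R s e = 0.
Proof.
move=> closedL.
have off0 := sum_base_edges_sign_off s (fun=> 1 : R) closedL.
rewrite (eq_bigr (edge_sign R s)) in off0; last by move=> e _; rewrite mulr1.
have := sum_base_edges_sign s.
by rewrite (bigID (fun e : {set 'I_n} => e \subset L)) /= off0 addr0.
Qed.

Lemma card_colored_edges s b : 2 * #|colored_edges s b|%:R = N.
Proof.
rewrite (@card_sum_indicator _ _ _ K); last first.
  by apply/fintype.subsetP => e; rewrite inE => /andP[].
rewrite (eq_bigr (fun e => 1 / 2 + (-1) ^+ b / 2 * edge_sign R s e)); last first.
  by move=> e eK; rewrite (colored_edgesE R) //; lra.
rewrite big_split /= sumr_const -mulr_sumr sum_base_edges_sign mulr0 addr0.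
by rewrite -mulr_natl; lra.
Qed.

(** With [p >= n - 1] paired vertices, [2 N = p^2 - 2 p], so [N >= (n - 1) (n - 3) / 2], which
    exceeds [n^2 / 4] from [n = 8] on. *)
Lemma card_base_edges_ge : (8 <= n)%N -> n%:R ^+ 2 / 4 <= N.
Proof.
move=> n_ge8; have := sum_base_edges_prod (fun _ : 'I_n => 1 : R).
rewrite (eq_bigr (fun=> 1)); last by move=> e _; rewrite big1.
rewrite [X in _ = _ - X](eq_bigr (fun=> 2 : R)); last by move=> u _; ring.
rewrite !sumr_const -[2 *+ _]mulr_natr.
have := card_paired n; rewrite cardsE.
rewrite -(ler_nat R) -subn1 natrB; last by lia.
have : (8 : R) <= n%:R by rewrite ler_nat.
by move: (n%:R : R) (#|[pred u | paired u]|%:R : R) => x y; nra.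
Qed.

Lemma bipartite_colored_graph s : bipartite (colored_graph s true).
Proof.
exists (color s) => i j; rewrite inE pair_base_edges => /andP[/and4P[_ _ ji _]].
rewrite /edge_parity big_setU1 ?inE 1?eq_sym //= big_set1.
by case: (color s i); case: (color s j).
Qed.

(** In [sum_base_edges_prod] the square is nonnegative and each vertex subtracts at most 2. For
    signs [g], this says that a cut contains at most [n / 2] more than half of the base edges. *)
Lemma sum_base_edges_prod_ge (g : 'I_n -> R) : (forall u, `|g u| = 1) ->
  - n%:R <= \sum_(e in K) \prod_(u in e) g u.
Proof.
move=> g1; have := sum_base_edges_prod g.
have : \sum_(u | paired u) (g u ^+ 2 + g u * g (mate u)) <= n%:R * 2.
  apply: (@le_trans _ _ (\sum_(u | paired u) 2)).
    apply: ler_sum => u _; have -> : 2 = 1 + 1 :> R by ring.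
    apply: lerD; apply: le_trans (ler_norm _) _.
      by rewrite normrX g1 expr1n.
    by rewrite normrM !g1 mulr1.
  rewrite sumr_const -[leLHS]mulr_natl ler_pM2r // ler_nat.
  by apply: leq_trans (max_card _) _; rewrite card_ord.
have := sqr_ge0 (\sum_(u | paired u) g u); lra.
Qed.

Lemma far_colored_graph s : (100 <= n)%N ->
  far_from_bipartite (1 / 100 : R) (colored_graph s false).
Proof.
move=> n_ge H [side sideH].
have n_geR : (100 : R) <= n%:R by rewrite ler_nat.
have N_ge : n%:R ^+ 2 / 4 <= N by apply: card_base_edges_ge; lia.
set G := colored_graph s false.
pose f u : R := (-1) ^+ side u; pose g u : R := (-1) ^+ color s u.
have f1 u : `|f u| = 1 by rewrite normrX normrN1 expr1n.
have g1 u : `|g u| = 1 by rewrite normrX normrN1 expr1n.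
have fge := sum_base_edges_prod_ge f1.
have gfge : - n%:R <= \sum_(e in K) \prod_(u in e) (g u * f u).
  by apply: sum_base_edges_prod_ge => u; rewrite normrM f1 g1 mulr1.
have : (#|edges G :\: edges H|)%:R <= (edge_diff G H)%:R :> R.
  by rewrite ler_nat /edge_diff subset_leq_card // finset.subsetUl.
apply: le_trans.
rewrite (@card_sum_indicator _ _ _ K); last first.
  by apply/fintype.subsetP => e; rewrite finset.in_setD => /andP[_]; rewrite inE => /andP[].
(* [lower e] is the product of the indicators [(1 + edge_sign R s e) / 2] of [G] and
   [(1 + f i * f j) / 2] of lying within one side of [H]; such an edge is missing from [H]. The four
   resulting sums are [N], 0 and two that are at least [-n], so the total is at least
   [(N - 2 n) / 4]. *)
pose lower e : R := (1 + edge_sign R s e + \prod_(u in e) f u +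
  \prod_(u in e) (g u * f u)) / 4.
apply: (@le_trans _ _ (\sum_(e in K) lower e)).
  rewrite -mulr_suml !big_split /= sumr_const sum_base_edges_sign.
  by nra.
apply: ler_sum => e eK; rewrite /lower big_split /= -/(edge_sign R s e).
have /eqP/cards2P[i [j [ij e_ij]]] := base_edges_card2 eK.
have -> : \prod_(u in e) f u = f i * f j by rewrite e_ij prod_set2 // eq_sym.
have xE := colored_edgesE R s false eK; rewrite expr0 mul1r in xE.
rewrite finset.in_setD /=.
have [eH|eNH] := boolP (e \in edges H) => /=.
  rewrite e_ij in eH; have := sideH _ _ eH.
  by rewrite /f; case: (side i); case: (side j) => //= _; rewrite ?expr0 ?expr1; lra.
rewrite xE /f edge_signE.
by case: (side i); case: (side j); case: (edge_parity s e) => /=; rewrite ?expr0 ?expr1; lra.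
Qed.

End ColoredGraph.

(** * Likelihood ratios against uniform base edges *)

(** The expectation over [t] independent uniform base edges, iterated so that inductions can
    integrate out one query at a time. *)
Fixpoint edge_mean (R : realType) (n t : nat) (F : seq {set 'I_n} -> R) : R :=
  if t is t'.+1 then
    (\sum_(e in base_edges n) edge_mean t' (fun es => F (e :: es)))
      / #|base_edges n|%:R
  else F [::].

Section EdgeMean.
Variables (R : realType) (n : nat).
Implicit Types (s : {ffun 'I_n -> bool}) (e L : {set 'I_n}) (Ls es : seq {set 'I_n}).
Implicit Types (F G : seq {set 'I_n} -> R).

Local Notation K := (base_edges n).
Local Notation N := (#|base_edges n|%:R : R).

Lemma eq_edge_mean t F G : F =1 G -> edge_mean t F = edge_mean t G.
Proof.
elim: t F G => [|t IH] F G FG /=; first exact: FG.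
by congr (_ / _); apply: eq_bigr => e _; apply: IH => es; exact: FG.
Qed.

Lemma edge_meanZ t (a : R) F :
  edge_mean t (fun es => a * F es) = a * edge_mean t F.
Proof.
elim: t F => [|t IH] F //=; rewrite mulrA mulr_sumr; congr (_ / _).
by apply: eq_bigr => e _; exact: IH.
Qed.

Lemma edge_meanD t F G :
  edge_mean t (fun es => F es + G es) = edge_mean t F + edge_mean t G.
Proof.
elim: t F G => [|t IH] F G //=; rewrite -mulrDl -big_split; congr (_ / _).
by apply: eq_bigr => e _; exact: IH.
Qed.

Lemma edge_mean_sum (I : finType) t (H : I -> seq {set 'I_n} -> R) :
  edge_mean t (fun es => \sum_i H i es) = \sum_i edge_mean t (H i).
Proof.
elim: t H => [|t IH] H //=; rewrite -mulr_suml exchange_big; congr (_ / _).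
by apply: eq_bigr => e _; exact: IH.
Qed.

Lemma edge_mean_le t F G :
  (forall es, F es <= G es) -> edge_mean t F <= edge_mean t G.
Proof.
elim: t F G => [|t IH] F G FG /=; first exact: FG.
by rewrite ler_wpM2r ?invr_ge0 // ler_sum // => e _; apply: IH => es; exact: FG.
Qed.

Lemma edge_mean_prod Ls (h : {set 'I_n} -> {set 'I_n} -> R) :
  edge_mean (size Ls) (fun es => \prod_(p <- zip es Ls) h p.2 p.1) =
  \prod_(L <- Ls) ((\sum_(e in K) h L e) / N).
Proof.
elim: Ls => [|L Ls IH] /=; first by rewrite !big_nil.
rewrite big_cons -IH mulrAC; congr (_ / _).
rewrite mulr_suml; apply: eq_bigr => e _; rewrite -edge_meanZ.
by apply: eq_edge_mean => es; rewrite big_cons.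
Qed.

Lemma edge_mean_const t (a : R) : 0 < N -> edge_mean (n := n) t (fun=> a) = a.
Proof.
move=> N_gt0; elim: t => [|t IH] //=; rewrite IH sumr_const -[a *+ _]mulr_natr mulfK //.
exact: lt0r_neq0.
Qed.

Lemma sum_tuple_cons (T : finType) t (F : seq T -> R) :
  \sum_(x : t.+1.-tuple T) F x = \sum_(a : T) \sum_(y : t.-tuple T) F (a :: y).
Proof.
rewrite pair_big /= (reindex (fun p : T * t.-tuple T => [tuple of p.1 :: p.2])) //=.
exists (fun x : t.+1.-tuple T => (thead x, [tuple of behead x])).
  by move=> [a y] _; rewrite /= theadE; congr (_, _); exact/val_inj.
by move=> x _ /=; rewrite [RHS]tuple_eta.
Qed.

(** Change of measure: each coloured graph holds half of the base edges, so its uniform edge has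
    density [1 + (-1) ^+ b * edge_sign R s e] relative to a uniform base edge. *)
Lemma sum_colored_tuples s b t F : 0 < N ->
  \sum_(es : t.-tuple {set 'I_n})
     (all (fun e => e \in colored_edges s b) es)%:R * F es =
  #|colored_edges s b|%:R ^+ t *
    edge_mean t (fun es => \prod_(e <- es) (1 + (-1) ^+ b * edge_sign R s e) * F es).
Proof.
move=> N_gt0; elim: t F => [|t IH] F.
  rewrite (eq_bigr (fun=> F [::])); last by move=> x _; rewrite tuple0 mul1r.
  by rewrite sumr_const card_tuple expn0 mulr1n expr0 mul1r /= big_nil mul1r.
rewrite (sum_tuple_cons t (fun es =>
  (all (fun e => e \in colored_edges s b) es)%:R * F es)) /=.
rewrite (bigID [in K]) /= [X in _ + X]big1 ?addr0; last first.
  move=> e eNK; apply: big1 => y _; rewrite [e \in _]inE (negbTE eNK).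
  by rewrite mul0r.
rewrite mulrA mulrAC exprSr mulr_sumr; apply: eq_bigr => e eK.
under eq_bigr => y _ do rewrite -mulnb natrM -mulrA.
rewrite -mulr_sumr (IH (fun es => F (e :: es))) (colored_edgesE R) //.
under [in RHS]eq_edge_mean => es do rewrite big_cons -mulrA.
rewrite edge_meanZ -(card_colored_edges R s b); field.
have := card_colored_edges R s b; apply: contra_eq_neq => ->.
by rewrite mulr0 eq_sym gt_eqF.
Qed.

Lemma answers_prob_colored s b Ls (D : seq {set 'I_n} -> bool) : 0 < N ->
  answers_prob R (colored_graph s b) Ls D =
  edge_mean (size Ls) (fun es =>
    \prod_(e <- es) (1 + (-1) ^+ b * edge_sign R s e)
      * (D (oracle_answers es Ls))%:R).
Proof.
move=> N_gt0; rewrite /answers_prob -sum1_card natr_sum.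
rewrite big_mkcond /= (eq_bigr (fun es : (size Ls).-tuple {set 'I_n} =>
   (all (fun e => e \in colored_edges s b) es)%:R *
     (D (oracle_answers es Ls))%:R)); last first.
  move=> es _; rewrite inE -natrM mulnb.
  by case: (_ && _).
rewrite (sum_colored_tuples s b (size Ls) (fun es => (D (oracle_answers es Ls))%:R)) //.
rewrite natrX mulrC mulKf // expf_neq0 //.
have := card_colored_edges R s b; apply: contra_eq_neq => /= ->.
by rewrite mulr0 eq_sym gt_eqF.
Qed.

(** For mate-closed [L], the conditional mean of the sign of a uniform base edge [e] given the
    answer [e :&: L]. *)
Definition visible_sign s L e : R := if e \subset L then edge_sign R s e else 0.

Lemma edge_mean_visible (a : R) s Ls F :
  {in Ls, forall L, mate_closed L} ->
  edge_mean (size Ls) (fun es =>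
    \prod_(e <- es) (1 + a * edge_sign R s e) * F (oracle_answers es Ls)) =
  edge_mean (size Ls) (fun es =>
    \prod_(p <- zip es Ls) (1 + a * visible_sign s p.2 p.1)
      * F (oracle_answers es Ls)).
Proof.
elim: Ls F => [|L Ls IH] F closedLs /=; first by rewrite !big_nil.
have closedL : mate_closed L by apply: closedLs; rewrite inE eqxx.
have {}IH F' := IH F' (fun L' L'in => closedLs L' (mem_behead (s := L :: Ls) L'in)).
congr (_ / _).
(* [phi A] is the weighted mean over the remaining queries when the first answer is [A]. The two
   sides then differ by [a] times a sum that [sum_base_edges_sign_off] makes zero. *)
pose phi A := edge_mean (size Ls) (fun es =>
  \prod_(p <- zip es Ls) (1 + a * visible_sign s p.2 p.1)
    * F (A :: oracle_answers es Ls)).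
rewrite (eq_bigr (fun e => (1 + a * edge_sign R s e) * phi (e :&: L))); last first.
  move=> e _; rewrite /phi -(IH (fun A => F (e :&: L :: A))) -edge_meanZ; apply: eq_edge_mean => es.
  by rewrite big_cons /= mulrA.
rewrite [RHS](eq_bigr (fun e => (1 + a * visible_sign s L e) * phi (e :&: L))); last first.
  move=> e _; rewrite /phi -edge_meanZ; apply: eq_edge_mean => es.
  by rewrite big_cons /= mulrA.
apply/eqP; rewrite -subr_eq0 -sumrB; apply/eqP.
rewrite -[RHS](mulr0 a) -[in RHS](sum_base_edges_sign_off s phi closedL) mulr_sumr.
rewrite [RHS]big_mkcondr /=; apply: eq_bigr => e _; rewrite /visible_sign.
by case: (e \subset L) => /=; ring.
Qed.

End EdgeMean.

(** * Second moment of a single query *)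

Definition fiber_size (n : nat) (L : {set 'I_n}) (v : 'I_n) : nat :=
  #|[set u in L | paired u && (base u == v)]|.

Section SecondMoment.
Variables (R : realType) (n : nat).
Implicit Types (s r : {ffun 'I_n -> bool}) (e L : {set 'I_n}) (Ls es : seq {set 'I_n}).

Local Notation K := (base_edges n).
Local Notation N := (#|base_edges n|%:R : R).

(** The sum [T_L] of the opening outline. Vertices of [L] are grouped by pair, so that distinct
    terms carry independent signs when [r] is random. *)
Definition fiber_sum r L : R :=
  \sum_(v <- enum (@base n @: L)) (fiber_size L v)%:R * (-1) ^+ r v.

Lemma fiber_size_le2 L v : `|(fiber_size L v)%:R : R| <= 2.
Proof.
rewrite ger0_norm // ler_nat /fiber_size.
have [->|[u]] := set_0Vmem [set u in L | paired u && (base u == v)].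
  by rewrite cards0.
rewrite inE => /and3P[_ _ /eqP uv].
apply: leq_trans (_ : #|[set u; mate u]| <= 2)%N; last by rewrite cards2; case: eqP.
apply/subset_leq_card/fintype.subsetP => w; rewrite !inE => /and3P[_ _ /eqP wv].
by case: (@base_eq n u w); rewrite ?uv ?wv // => ->; rewrite eqxx ?orbT.
Qed.

(** [sum_base_edges_prod] is applied to the signs cut off outside [L]. Mates share their sign
    [r (base u)], so all subtracted terms are nonnegative. *)
Lemma sum_base_edges_within r L :
  2 * \sum_(e in K | e \subset L) \prod_(u in e) (-1) ^+ r (base u)
    <= fiber_sum r L ^+ 2.
Proof.
pose g u : R := (u \in L)%:R * (-1) ^+ r (base u).
have -> : \sum_(e in K | e \subset L) \prod_(u in e) (-1) ^+ r (base u) =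
    \sum_(e in K) \prod_(u in e) g u :> R.
  rewrite big_mkcondr; apply: eq_bigr => e _; case: ifP => [/fintype.subsetP eL|/negbT].
    by apply: eq_bigr => u ue; rewrite /g eL // mul1r.
  case/fintype.subsetPn => u ue uNL; rewrite (bigD1 u) //= /g (negbTE uNL).
  by rewrite !mul0r.
rewrite sum_base_edges_prod.
have -> : \sum_(u | paired u) g u = fiber_sum r L.
  rewrite /fiber_sum big_enum /=.
  rewrite (eq_bigr (fun u => if u \in L then (-1) ^+ r (base u) else 0)); last first.
    by move=> u _; rewrite /g; case: (_ \in _); rewrite ?mul1r ?mul0r.
  rewrite -big_mkcondr /= (partition_big (@base n) [in @base n @: L]) /=; last first.
    by move=> u /andP[_ uL]; exact: imset_f.
  apply: eq_bigr => v _; rewrite (eq_bigr (fun=> (-1) ^+ r v)); last first.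
    by move=> u /andP[_ /eqP->].
  rewrite sumr_const mulr_natl; congr (_ *+ _); apply: eq_card => u.
  by rewrite !inE unfold_in /= andbAC andbC andbA.
rewrite gerBl sumr_ge0 // => u _; rewrite addr_ge0 ?sqr_ge0 //.
rewrite /g base_mate mulrACA -expr2 sqrr_sign mulr1 mulr_ge0 //.
Qed.

(** The alternation [odd u] within a pair occurs in both colourings and cancels, leaving only the
    xor of [s] and [s']. *)
Lemma edge_sign_mul s s' e :
  edge_sign R s e * edge_sign R s' e =
  \prod_(u in e) (-1) ^+ [ffun v => s v (+) s' v] (base u).
Proof.
rewrite /edge_sign -big_split; apply: eq_bigr => u _ /=.
rewrite ffunE -signr_addb /color; congr (_ ^+ _).
by case: (s _); case: (s' _); case: (odd u).
Qed.

Lemma sum_visible s L : mate_closed L -> \sum_(e in K) visible_sign R s L e = 0.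
Proof. by move=> closedL; rewrite -big_mkcondr /= sum_base_edges_sign_on. Qed.

Lemma visible_mean (a : R) s L : 0 < N -> mate_closed L ->
  (\sum_(e in K) (1 + a * visible_sign R s L e)) / N = 1.
Proof.
move=> N_gt0 closedL; rewrite big_split /= -mulr_sumr sum_visible // mulr0 addr0.
by rewrite sumr_const divff // lt0r_neq0.
Qed.

Lemma visible_norm_le1 s L e : `|visible_sign R s L e| <= 1.
Proof.
rewrite /visible_sign; case: ifP => _; last by rewrite normr0.
by rewrite edge_signE normrX normrN1 expr1n.
Qed.

(** The linear terms sum to zero, so the mean is [1 + Y / N] with [Y] controlled by
    [sum_base_edges_within], and [1 + x <= expR x]. Nonnegativity allows these bounds to be
    multiplied over the queries. *)
Lemma visible_second_moment_le (a : R) s s' L : 0 < N -> mate_closed L -> a ^+ 2 = 1 ->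
  0 <= (\sum_(e in K) (1 + a * visible_sign R s L e) * (1 + a * visible_sign R s' L e)) / N
    <= expR (fiber_sum [ffun v => s v (+) s' v] L ^+ 2 / (2 * N)).
Proof.
move=> N_gt0 closedL a2.
have a1 : `|a| = 1 by apply/eqP; rewrite -sqrp_eq1 // -normrX a2 normr1.
have ge0 t e : 0 <= 1 + a * visible_sign R t L e.
  have : `|a * visible_sign R t L e| <= 1 by rewrite normrM a1 mul1r visible_norm_le1.
  by rewrite ler_norml => /andP[]; lra.
apply/andP; split.
  by rewrite divr_ge0 ?ler0n // sumr_ge0 // => e _; rewrite mulr_ge0.
apply: le_trans (expR_ge1Dx _).
set Y := \sum_(e in K | e \subset L)
  \prod_(u in e) (-1) ^+ [ffun v => s v (+) s' v] (base u) : R.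
have -> : \sum_(e in K) (1 + a * visible_sign R s L e) * (1 + a * visible_sign R s' L e)
    = N + Y.
  rewrite (eq_bigr (fun e => (1 + a * visible_sign R s L e) +
     (a * visible_sign R s' L e + (if e \subset L then
       \prod_(u in e) (-1) ^+ [ffun v => s v (+) s' v] (base u) else 0)))); last first.
    move=> e _; rewrite -edge_sign_mul /visible_sign; case: ifP => _; last by ring.
    transitivity (1 + a * edge_sign R s e + a * edge_sign R s' e +
       a ^+ 2 * (edge_sign R s e * edge_sign R s' e)); first by ring.
    by rewrite a2; ring.
  rewrite !big_split /= -!mulr_sumr !sum_visible // -big_mkcondr /= sumr_const.
  by rewrite -/Y; ring.
rewrite mulrDl divff ?lt0r_neq0 // lerD2l.
have := sum_base_edges_within [ffun v => s v (+) s' v] L; rewrite -/Y => Y_le.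
by rewrite invfM mulrA ler_pM2r ?invr_gt0 //; lra.
Qed.

End SecondMoment.

(** * Closing queries under mates *)

Definition mate_closure (n : nat) (L : {set 'I_n}) : {set 'I_n} := L :|: @mate n @: L.

Lemma mate_closure_closed (n : nat) (L : {set 'I_n}) : mate_closed (mate_closure L).
Proof.
move=> u; rewrite !inE orbC (mem_imset _ _ (inv_inj (@mateK n))); congr (_ || _).
by rewrite -[in RHS](mateK u) (mem_imset _ _ (inv_inj (@mateK n))).
Qed.

Lemma card_mate_closure (n : nat) (L : {set 'I_n}) :
  (#|mate_closure L| <= 2 * #|L|)%N.
Proof.
rewrite mul2n -addnn; apply: leq_trans (leq_card_setU _ _) _.
by rewrite leq_add2l leq_imset_card.
Qed.

(* A query [L] is answered by intersecting the answer to a superset with [L]. *)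
Lemma oracle_answers_closure (n : nat) (es Ls : seq {set 'I_n}) :
  oracle_answers es Ls =
  oracle_answers (oracle_answers es [seq mate_closure L | L <- Ls]) Ls.
Proof.
elim: es Ls => [|e es IH] [|L Ls] //=; rewrite /oracle_answers /= in IH *.
have LcL : mate_closure L :&: L = L by apply/finset.setIidPr; exact: finset.subsetUl.
by rewrite -IH -finset.setIA LcL.
Qed.

(** * Indistinguishability of the two mixtures *)

Section Indistinguishable.
Variables (R : realType) (n : nat).
Implicit Types (s r : {ffun 'I_n -> bool}) (e L : {set 'I_n}) (Ls es : seq {set 'I_n}).

Local Notation K := (base_edges n).
Local Notation N := (#|base_edges n|%:R : R).
Local Notation M := (#|{ffun 'I_n -> bool}|%:R : R).
Local Notation total Ls := ((\sum_(L <- Ls) #|L|)%N%:R : R).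

(** For [a] equal to 1 or -1 and mate-closed queries, the likelihood ratio of the answers under the
    colouring [s]. *)
Definition visible_weight (a : R) s Ls es : R :=
  \prod_(p <- zip es Ls) (1 + a * visible_sign R s p.2 p.1).

Lemma card_colorings_gt0 : 0 < M.
Proof. by rewrite ltr0n; apply/card_gt0P; exists [ffun=> true]. Qed.

Lemma size_base_image L : (size (enum (@base n @: L)) <= #|L|)%N.
Proof. by rewrite -cardE leq_imset_card. Qed.

Lemma fiber_sum_eq0 r L : #|L| = 0%N -> fiber_sum R r L = 0.
Proof.
move=> L0; rewrite /fiber_sum; have := size_base_image L; rewrite L0 leqn0.
by move=> /nilP->; rewrite big_nil.
Qed.

Lemma sum_expR_fiber_sum Ls : 0 < N -> 200 * total Ls <= N ->
  \sum_r expR (\sum_(L <- Ls) fiber_sum R r L ^+ 2 / (2 * N))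
    <= M * expR (4 * total Ls / N).
Proof.
move=> N_gt0 Ls_le; set S := total Ls in Ls_le *.
have S_ge0 : 0 <= S by exact: ler0n.
have SE : S = \sum_(L <- Ls) #|L|%:R by rewrite /S natr_sum.
(* If [S = 0], all queries are empty and the Jensen weights [#|L| / S] would not sum to 1. *)
have [S0|S_neq0] := eqVneq S 0.
  rewrite S0 mulr0 mul0r expR0 mulr1 (eq_bigr (fun=> 1)) ?sumr_const // => r _.
  rewrite big_seq big1 ?expR0 // => L LLs; rewrite fiber_sum_eq0 ?expr0n ?mul0r //.
  have /eqP := S0; rewrite SE psumr_eq0 // => /allP/(_ _ LLs).
  by rewrite /= pnatr_eq0 => /eqP.
have S_gt0 : 0 < S by rewrite lt_neqAle eq_sym S_neq0.
pose w L : R := #|L|%:R / S.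
have w_ge0 L : 0 <= w L by rewrite divr_ge0.
have w_sum : \sum_(L <- Ls) w L = 1 by rewrite -mulr_suml -SE divff.
(* Chosen so that [w L * c L = 1 / (2 N)], and [c L * #|L|] is the same for all nonempty [L]. For an
   empty [L], division by zero makes [c L] equal to 0. *)
pose c L : R := S / (2 * N * #|L|%:R).
have c_ge0 L : 0 <= c L by rewrite divr_ge0 // !mulr_ge0.
have c_card L : c L * (size (enum (@base n @: L)))%:R <= S / (2 * N).
  have [L0|L_gt0] := posnP #|L|.
    by rewrite /c L0 mulr0 invr0 mulr0 mul0r divr_ge0 // mulr_ge0.
  apply: (@le_trans _ _ (c L * #|L|%:R)).
    by rewrite ler_wpM2l // ler_nat size_base_image.
  by rewrite /c invfM mulrA mulfVK // pnatr_eq0 -lt0n.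
have SN : S / (2 * N) <= 1 / 400.
  by rewrite ler_pdivrMr ?mulr_gt0 //; lra.
have wc L r : fiber_sum R r L ^+ 2 / (2 * N) = w L * (c L * fiber_sum R r L ^+ 2).
  have [L0|L_gt0] := posnP #|L|; first by rewrite fiber_sum_eq0 // expr0n !(mul0r, mulr0).
  rewrite /w /c; field.
  by apply/and3P; split; [rewrite pnatr_eq0 -lt0n | exact: lt0r_neq0 | exact: S_neq0].
apply: (@le_trans _ _ (\sum_r \sum_(L <- Ls) w L * expR (c L * fiber_sum R r L ^+ 2))).
  apply: ler_sum => r _; under eq_bigr do rewrite wc.
  exact: expR_jensen.
rewrite exchange_big /=; set B := leRHS.
have -> : B = \sum_(L <- Ls) w L * B by rewrite -mulr_suml w_sum mul1r.
apply: ler_sum => L _.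
rewrite -mulr_sumr ler_wpM2l //.
apply: le_trans (rademacher_sqr_expR_moment _ _ _ _) _.
- exact: enum_uniq.
- by move=> v; exact: fiber_size_le2.
- exact: c_ge0.
- by have := c_card L; lra.
rewrite /B ler_wpM2l // ler_expR.
have -> : 4 * S / N = 8 * (S / (2 * N)) by field; exact: lt0r_neq0.
by rewrite -[leLHS]mulrA ler_pM2l.
Qed.

Lemma visible_weight_first_moment (a : R) Ls : 0 < N ->
  {in Ls, forall L, mate_closed L} ->
  edge_mean (size Ls) (fun es => \sum_s visible_weight a s Ls es) = M.
Proof.
move=> N_gt0 closedLs; rewrite edge_mean_sum -sumr_const; apply: eq_bigr => s _.
rewrite (edge_mean_prod Ls (fun L e => 1 + a * visible_sign R s L e)).
by rewrite big_seq big1 // => L LLs; rewrite visible_mean //; exact: closedLs.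
Qed.

(** The square expands over pairs of colourings, whose means factor over the queries. The bound
    depends only on the xor of the pair, which for fixed [s] runs once through all colourings. *)
Lemma visible_weight_second_moment (a : R) Ls : 0 < N -> a ^+ 2 = 1 ->
  {in Ls, forall L, mate_closed L} -> 200 * total Ls <= N ->
  edge_mean (size Ls) (fun es => (\sum_s visible_weight a s Ls es) ^+ 2)
    <= M ^+ 2 * (50 / 49).
Proof.
move=> N_gt0 a2 closedLs Ls_le.
rewrite (@eq_edge_mean _ _ _ _ (fun es => \sum_s \sum_s'
    visible_weight a s Ls es * visible_weight a s' Ls es)); last first.
  move=> es; rewrite expr2 mulr_suml; apply: eq_bigr => s _.
  by rewrite mulr_sumr.
rewrite edge_mean_sum.
pose E r := expR (\sum_(L <- Ls) fiber_sum R r L ^+ 2 / (2 * N)).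
have mean_le s s' : edge_mean (size Ls) (fun es =>
    visible_weight a s Ls es * visible_weight a s' Ls es)
    <= E [ffun v => s v (+) s' v].
  rewrite (@eq_edge_mean _ _ _ _ (fun es => \prod_(p <- zip es Ls)
     ((1 + a * visible_sign R s p.2 p.1) * (1 + a * visible_sign R s' p.2 p.1)))); last first.
    by move=> es; rewrite big_split.
  rewrite (edge_mean_prod Ls (fun L e =>
     (1 + a * visible_sign R s L e) * (1 + a * visible_sign R s' L e))).
  rewrite /E expR_sum big_seq [leRHS]big_seq; apply: ler_prod => L LLs.
  by apply: visible_second_moment_le => //; exact: closedLs.
have sum_le : \sum_s edge_mean (size Ls) (fun es => \sum_s'
    visible_weight a s Ls es * visible_weight a s' Ls es)
    <= \sum_(s : {ffun 'I_n -> bool}) \sum_(s' : {ffun 'I_n -> bool})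
         E [ffun v => s v (+) s' v].
  by apply: ler_sum => s _; rewrite edge_mean_sum; apply: ler_sum => s' _; exact: mean_le.
apply: le_trans sum_le _.
rewrite (eq_bigr (fun=> \sum_r E r)); last first.
  move=> s _; pose shift (r : {ffun 'I_n -> bool}) := [ffun v => s v (+) r v].
  have shiftK : involutive shift by move=> r; apply/ffunP => v; rewrite !ffunE addKb.
  by rewrite [RHS](reindex_inj (inv_inj shiftK)).
rewrite sumr_const -[leLHS]mulr_natl expr2 -mulrA ler_wpM2l //.
apply: le_trans (sum_expR_fiber_sum N_gt0 Ls_le) _; rewrite ler_wpM2l //.
have x_le : 4 * total Ls / N <= 1 / 50 by rewrite ler_pdivrMr //; lra.
apply: (@le_trans _ _ (expR (1 / 50))); first by rewrite ler_expR.
(* [expR x <= 1 / (1 - x)] at [x = 1 / 50] is the origin of [50 / 49]. *)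
have := expR_ge1Dx (- (1 / 50) : R); have := expRxMexpNx_1 (1 / 50 : R).
have := expR_gt0 (1 / 50 : R).
by move: (expR (1 / 50)) (expR (- (1 / 50))) => x y; nra.
Qed.

Lemma visible_weight_deviation (a : R) Ls : 0 < N -> a ^+ 2 = 1 ->
  {in Ls, forall L, mate_closed L} -> 200 * total Ls <= N ->
  edge_mean (size Ls) (fun es => `|\sum_s visible_weight a s Ls es - M|)
    <= M * (3 / 20).
Proof.
move=> N_gt0 a2 closedLs Ls_le; have M_gt0 := card_colorings_gt0.
(* AM-GM: [`|x - M| <= 3 (x - M)^2 / M + M / 12] *)
apply: (@le_trans _ _ (edge_mean (size Ls) (fun es =>
    3 / M * (\sum_s visible_weight a s Ls es) ^+ 2
    + (- 6 * (\sum_s visible_weight a s Ls es) + (3 + 1 / 12) * M)))).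
  apply: edge_mean_le => es; set x := \sum_s _.
  have -> : 3 / M * x ^+ 2 + (- 6 * x + (3 + 1 / 12) * M) =
      (3 * (x - M) ^+ 2 + M ^+ 2 / 12) / M by field; exact: lt0r_neq0.
  rewrite ler_pdivlMr // -(real_normK (num_real (x - M))).
  have := sqr_ge0 (6 * `|x - M| - M); nra.
(* The total is [(150/49 - 6 + 3 + 1/12) M], slightly below [3/20 M]. *)
rewrite !edge_meanD !edge_meanZ edge_mean_const // visible_weight_first_moment //.
have := visible_weight_second_moment N_gt0 a2 closedLs Ls_le.
set Q := edge_mean _ _ => Q_le.
have : 3 / M * Q <= 3 / M * (M ^+ 2 * (50 / 49)) by rewrite ler_wpM2l // divr_ge0.
have -> : 3 / M * (M ^+ 2 * (50 / 49)) = 150 / 49 * M by field; exact: lt0r_neq0.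
by move=> ?; lra.
Qed.

(** Replacing both mixture weights by [M] costs at most [3/20 M] each. What remains is [M], because
    exactly one of [D] and its negation holds; hence [13/10 = 1 + 2 * 3/20]. *)
Lemma closed_queries_indistinguishable Ls (D : seq {set 'I_n} -> bool) : 0 < N ->
  {in Ls, forall L, mate_closed L} -> 200 * total Ls <= N ->
  \sum_s (edge_mean (size Ls) (fun es => \prod_(e <- es)
            (1 + (-1) ^+ true * edge_sign R s e) * (D (oracle_answers es Ls))%:R)
        + edge_mean (size Ls) (fun es => \prod_(e <- es)
            (1 + (-1) ^+ false * edge_sign R s e) * (~~ D (oracle_answers es Ls))%:R))
    <= M * (13 / 10).
Proof.
move=> N_gt0 closedLs Ls_le.
pose G b es := \sum_s visible_weight ((-1) ^+ (b : bool)) s Ls es.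
have D_le b : edge_mean (size Ls) (fun es => `|G b es - M|) <= M * (3 / 20).
  by apply: visible_weight_deviation => //; rewrite sqrr_sign.
rewrite (eq_bigr (fun s => edge_mean (size Ls) (fun es =>
   visible_weight ((-1) ^+ true) s Ls es * (D (oracle_answers es Ls))%:R +
   visible_weight ((-1) ^+ false) s Ls es * (~~ D (oracle_answers es Ls))%:R))); last first.
  move=> s _; rewrite edge_meanD.
  by rewrite (edge_mean_visible _ _ (fun A => (D A)%:R) closedLs)
             (edge_mean_visible _ _ (fun A => (~~ D A)%:R) closedLs).
rewrite -edge_mean_sum.
apply: (@le_trans _ _ (edge_mean (size Ls) (fun es =>
   M + (`|G true es - M| + `|G false es - M|)))).
  apply: edge_mean_le => es; rewrite big_split /= -!mulr_suml -/(G true es) -/(G false es).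
  have := ler_norm (G true es - M); have := ler_norm (G false es - M).
  have := normr_ge0 (G true es - M); have := normr_ge0 (G false es - M).
  by case: (D _) => /=; lra.
rewrite !edge_meanD edge_mean_const //.
by have := D_le true; have := D_le false; lra.
Qed.

(** Closing under mates at most doubles the cost, which turns 200 into 400. *)
Lemma queries_indistinguishable Ls (D : seq {set 'I_n} -> bool) : 0 < N ->
  400 * total Ls <= N ->
  \sum_s (answers_prob R (colored_graph s true) Ls (fun ans => D ans == true)
        + answers_prob R (colored_graph s false) Ls (fun ans => D ans == false))
    <= M * (13 / 10).
Proof.
move=> N_gt0 Ls_le; pose Ls' := [seq mate_closure L | L <- Ls].
have closedLs' : {in Ls', forall L, mate_closed L}.
  by move=> _ /mapP[L _ ->]; exact: mate_closure_closed.
have Ls'_le : 200 * total Ls' <= N.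
  have : total Ls' <= 2 * total Ls; last by lra.
  rewrite -natrM ler_nat big_map big_distrr /=; apply: leq_sum => L _.
  exact: card_mate_closure.
apply: le_trans (closed_queries_indistinguishable
  (fun ans => D (oracle_answers ans Ls)) N_gt0 closedLs' Ls'_le).
rewrite size_map; apply: ler_sum => s _; rewrite !answers_prob_colored //.
by rewrite lerD // edge_mean_le // => es; rewrite -oracle_answers_closure; case: (D _).
Qed.

End Indistinguishable.

(** * Averaging over the seed of the tester *)

Lemma answers_prob_ge0 (R : realType) n (G : graph n) Ls D :
  0 <= answers_prob R G Ls D.
Proof. exact: divr_ge0. Qed.

(** There are countably many query lists, and for a fixed list the probability is a finite
    combination of indicators of events about [decide]. *)
Lemma measurable_answers_prob (R : realType) n (A : nonadaptive_alg R n)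
    (G : graph n) (b : bool) :
  measurable_fun setT (fun w : seed A =>
    (answers_prob R G (queries w) (fun ans => decide w ans == b))%:E).
Proof.
apply/measurable_EFinP.
pose g Ls (w : seed A) := answers_prob R G Ls (fun ans => decide w ans == b).
have mg Ls : measurable_fun setT (g Ls).
  pose A_ (es : (size Ls).-tuple {set 'I_n}) : set (seed A) :=
    [set w | decide w (oracle_answers es Ls) == b]%classic.
  have -> : g Ls = (fun w => (\sum_(es : (size Ls).-tuple {set 'I_n})
      (all (fun e => e \in edges G) es)%:R * \1_(A_ es) w) *
      (#|edges G| ^ size Ls)%:R^-1).
    apply/funext => w; rewrite /g /answers_prob -sum1_card natr_sum big_mkcond.
    congr (_ / _); apply: eq_bigr => es _; rewrite inE indicE /A_.
    case: (all _ es) => /=; rewrite ?mul0r ?mul1r //.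
    by case: ifPn => [Hw|/negP Hw]; [rewrite mem_set | rewrite memNset].
  apply: measurable_funM; last exact: measurable_cst.
  apply: measurable_sum => es; apply: measurable_funM; first exact: measurable_cst.
  apply: measurable_indic.
  have mdec := @measurable_decide _ _ A (oracle_answers es Ls).
  case: (b) @A_ => /=.
    by rewrite (_ : [set w | _]%classic = [set w | decide w (oracle_answers es Ls)]%classic) //;
      apply/seteqP; split => w /=; rewrite eqb_id.
  rewrite (_ : [set w | _]%classic = ~` [set w | decide w (oracle_answers es Ls)])%classic.
    exact: measurableC.
  by apply/seteqP; split => w /=; rewrite eqbF_neg => /negP.
move=> _ B mB; rewrite setTI.
rewrite (_ : _ @^-1` B = \bigcup_Ls
    ([set w | queries w = Ls] `&` (g Ls @^-1` B)))%classic.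
  apply: countable_bigcupT_measurable => [|Ls]; first exact: countableP.
  apply: measurableI; first exact: measurable_queries.
  by rewrite -[X in measurable X]setTI; exact: mg.
apply/seteqP; split=> [w /= Bw|w [Ls _ [/= <-]]] //.
by exists (queries w).
Qed.

Theorem theorem1p1 (R : realType) :
  exists eps : R, 0 < eps /\
  exists (c C : R) (N : nat), 0 < C /\
  forall n : nat, (N <= n)%N ->
  forall A : nonadaptive_alg R n, bipartiteness_tester eps A ->
    ((C * (n%:R ^+ 2 / ln (n%:R ^+ 2) `^ c))%:E <= cost A)%E.
Proof.
exists (1 / 100); split; first by lra.
(* A cost below [n^2 / 2000] gives [400 * total < n^2 / 5], less than [n^2 / 4 <= N]. The threshold
   100 is that of [far_colored_graph]. *)
exists 0, (1 / 2000), 100%N; split; first by lra.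
move=> n n_ge A testA; rewrite powRr0 divr1 leNgt; apply/negP => cost_lt.
have n_geR : (100 : R) <= n%:R by rewrite ler_nat.
have N_ge : n%:R ^+ 2 / 4 <= #|base_edges n|%:R :> R.
  by apply: card_base_edges_ge; lia.
have N_gt0 : 0 < #|base_edges n|%:R :> R by nra.
have total_le (w : seed A) :
    400 * (\sum_(L <- queries w) #|L|)%N%:R <= #|base_edges n|%:R :> R.
  have : ((\sum_(L <- queries w) #|L|)%N%:R%:E <= cost A)%E.
    by apply: ereal_sup_ubound; exists w.
  by move=> /le_lt_trans/(_ cost_lt); rewrite lte_fin; lra.
pose M : R := #|{ffun 'I_n -> bool}|%:R.
have M_gt0 : 0 < M := card_colorings_gt0 R n.
pose f (p : {ffun 'I_n -> bool} * bool) (w : seed A) : \bar R :=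
  (answers_prob R (colored_graph p.1 p.2) (queries w)
     (fun ans => decide w ans == p.2))%:E.
have mf p : measurable_fun setT (f p) by exact: measurable_answers_prob.
have f_ge0 p w : (0 <= f p w)%E by rewrite lee_fin answers_prob_ge0.
have edges_neq0 (s : {ffun 'I_n -> bool}) b : edges (colored_graph s b) != finset.set0.
  apply/eqP => /= E; have := card_colored_edges R s b; rewrite E cards0 mulr0.
  by move=> N0; move: N_gt0; rewrite -N0 ltxx.
have f_ge p : ((2 / 3)%:E <= \int[seed_law A]_w f p w)%E.
  case: p => s [].
    by have [] := testA _ (edges_neq0 s true); move=> /(_ (bipartite_colored_graph s)).
  have [_] := testA _ (edges_neq0 s false).
  by move=> /(_ (far_colored_graph R s n_ge)).
(* Correctness on all [2 M] graphs forces a total success probability of [4/3 M], whereas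
   indistinguishability, seed by seed, caps it at [13/10 M]. *)
have sum_ge : ((4 / 3 * M)%:E <= \sum_p \int[seed_law A]_w f p w)%E.
  apply: (@le_trans _ _ (\sum_(p : {ffun 'I_n -> bool} * bool) (2 / 3)%:E)%E).
    rewrite sumEFin sumr_const card_prod card_bool -[_ *+ (_ * _)]mulr_natr natrM lee_fin -/M.
    by lra.
  by apply: lee_sum => p _; exact: f_ge.
have sum_le : (\sum_p \int[seed_law A]_w f p w <= (M * (13 / 10))%:E)%E.
  rewrite -ge0_integral_sum //.
  apply: (@le_trans _ _ (\int[seed_law A]_w (cst (M * (13 / 10))%:E w))%E); last first.
    rewrite integral_cst // [X in (_ * X)%E](_ : _ = 1%E) ?mule1 //.
    exact: probability_setT.
  apply: ge0_le_integral => //.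
  - by move=> w _; apply: sume_ge0.
  - exact: emeasurable_sum.
  - move=> w _; rewrite /f sumEFin lee_fin.
    apply: le_trans (queries_indistinguishable (decide w) N_gt0 (total_le w)).
    rewrite -(pair_big predT predT (fun s b => answers_prob R (colored_graph s b)
      (queries w) (fun ans => decide w ans == b))) /=.
    by apply: ler_sum => s _; rewrite big_bool.
have := le_trans sum_ge sum_le; rewrite lee_fin; lra.
Qed.
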